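(* Let $f \colon \mathbb{N} \to \mathbb{U}$ be a non-pretentious finitely generated multiplicative function, and let $\mathcal{P} = \{p\in \mathbb{P}:f(p) \neq 1\}$. If there exists a function $\epsilon = \epsilon(x)$ taking values in $(1/\log\log x, 1/2)$ such that $\mathbb{D}(f,1;x^{\epsilon(x)},x)\to 0$ as $x\to\infty$, then $\mathcal{P}$ has lower relative density $0$ in the primes.
   Context: $\mathbb{N}=\{1,2,3,\dots\}$; $\mathbb{U}$ is the closed unit disk of $\mathbb{C}$; $\mathbb{P}$ is the set of primes; $p$ always denotes a prime. A function $f\colon\mathbb{N}\to\mathbb{U}$ is multiplicative if $f(1)=1$ and $f(mn)=f(m)f(n)$ whenever $\gcd(m,n)=1$. It is finitely generated if the set $\{f(p):p\in\mathbb{P}\}$ is finite. Pretentious distance: for $g_1,g_2\colon\mathbb{N}\to\mathbb{U}$ and $x>0$ (or $x=\infty$), $\mathbb{D}(g_1,g_2;x)=\Big(\sum_{p\le x}\frac{1-\mathrm{Re}(g_1(p)\overline{g_2(p)})}{p}\Big)^{1/2}$; the truncated distance $\mathbb{D}(g_1,g_2;x,y)$, $0<x<y$, is defined in the same way with the sum over primes $x<p\le y$. The symbol $1$ as an argument denotes the constant function $1$. A multiplicative function $f\colon\mathbb{N}\to\mathbb{U}$ is pretentious if there exist a Dirichlet character $\chi$ and $t\in\mathbb{R}$ with $\mathbb{D}(f,\,n\mapsto\chi(n)n^{it};\infty)<\infty$; otherwise it is non-pretentious. The lower relative density of $\mathcal{P}\subset\mathbb{P}$ in the primes is $\underline{d_{\mathbb{P}}}(\mathcal{P})=\liminf_{N\to\infty}\frac{|\mathcal{P}\cap\{1,\dots,N\}|}{|\mathbb{P}\cap\{1,\dots,N\}|}$.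 The interval $(1/\log\log x,1/2)$ is non-empty only for $x>e^{e^2}$; the function $\epsilon(x)$ is understood to be defined for all sufficiently large $x$. *)

(* Defs.v *)
From HB Require Import structures.
From mathcomp Require Import all_boot all_order all_algebra.
From mathcomp Require Import all_classical all_reals all_analysis.
From mathcomp Require Import complex.

Set Implicit Arguments.
Unset Strict Implicit.
Unset Printing Implicit Defensive.

Import Order.TTheory GRing.Theory Num.Theory.
Import numFieldNormedType.Exports.

Local Open Scope classical_set_scope.
Local Open Scope ring_scope.

(* Arithmetic functions on {1, 2, 3, ...} are represented by functions on nat
   whose value at 0 is never constrained nor used. *)

Section ArithmeticFunctions.
Context {R : realType}.
Implicit Types f g chi : nat -> R[i].

Definition unit_disk_valued f : Prop := forall n : nat, (0 < n)%N -> `|f n| <= 1.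

Definition multiplicative_fun f : Prop :=
  f 1%N = 1 /\
  forall m n : nat, (0 < m)%N -> (0 < n)%N -> coprime m n ->
    f (m * n)%N = f m * f n.

Definition finitely_generated f : Prop :=
  finite_set [set f p | p in [set p : nat | prime p]].

(* Dirichlet characters modulo q >= 1, as q-periodic completely multiplicative
   functions vanishing exactly off the residues coprime to q. *)
Definition dirichlet_character (q : nat) chi : Prop :=
  [/\ (0 < q)%N,
      forall n : nat, chi (n + q)%N = chi n,
      forall m n : nat, chi (m * n)%N = chi m * chi n,
      chi 1%N = 1 &
      forall n : nat, chi n != 0 <-> coprime n q].

(* n ^ (i t) = exp (i t log n), for n >= 1. *)
Definition nat_pow_it (t : R) (n : nat) : R[i] :=
  Complex (cos (t * ln n%:R)) (sin (t * ln n%:R)).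

Definition pretentious_term g1 g2 (p : nat) : R :=
  (1 - complex.Re (g1 p * conjc (g2 p))) / p%:R.

(* The sum is over the primes x < p <= y: the bound truncn y (the integer part
   of y >= 0) only makes the index range finite. *)
Definition pretentious_dist g1 g2 (x y : R) : R :=
  Num.sqrt (\sum_(0 <= p < (Num.truncn y).+1 | prime p && (x < p%:R <= y))
              pretentious_term g1 g2 p).

(* The terms are nonnegative for functions valued in the unit disk, so the
   series always has a value in [0, +oo]. *)
Definition pretentious_dist_oo g1 g2 : \bar R :=
  sqrte (\sum_(0 <= p <oo | prime p) (pretentious_term g1 g2 p)%:E)%E.

Definition pretentious f : Prop :=
  exists (q : nat) (chi : nat -> R[i]) (t : R),
    dirichlet_character q chi /\
    (pretentious_dist_oo f (fun n => (chi n * nat_pow_it t n)%R) < +oo)%E.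

End ArithmeticFunctions.

Definition count_upto (A : set nat) (N : nat) : nat :=
  count (fun n => n \in A) (iota 1 N).

(* The quotients lie in [0, 1], so the real-valued limn_inf is the genuine
   liminf; for N < 2 the quotient is 0 / 0 = 0, which does not affect it. *)
Definition lower_prime_density (R : realType) (P : set nat) : R :=
  limn_inf (fun N : nat =>
    (count_upto P N)%:R / (count_upto [set p | prime p] N)%:R : R).

(* Main.v *)
Require Import Defs.
From HB Require Import structures.
From mathcomp Require Import all_boot all_order all_algebra.
From mathcomp Require Import all_classical all_reals all_analysis.
From mathcomp Require Import complex ring lra zify.

Set Implicit Arguments.
Unset Strict Implicit.
Unset Printing Implicit Defensive.

Import Order.TTheory GRing.Theory Num.Theory.
Import numFieldNormedType.Exports.

Local Open Scope classical_set_scope.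
Local Open Scope ring_scope.

(** Write [P] for the set of primes [p] with [f p <> 1]. As [f] takes finitely
    many values at primes, all in the closed unit disk, there is [c > 0] with
    [1 - Re (f p) >= c] for every [p] in [P]. Since [eps x < 1 / 2], the squared
    distance at [x] is therefore at least [c] times the sum of [1 / p] over the
    [p] in [P] with [sqrt x < p <= x]. Taking [x = 4 ^ m], the hypothesis gives

      S(m) := sum of 1 / p over p in P, 2 ^ m < p <= 2 ^ (2 m),   S(m) --> 0.

    It remains to see that this is impossible when [P] has positive lower
    density ([recip_sum_large]). Let [A i] be the number of elements of [P] up
    to [2 ^ i], divided by [2 ^ i]. Positive lower density, together with
    Chebyshev's lower bound for the number of primes ([prime_count_pow2]), gives
    [A i >= d / i] for some [d > 0] and all large [i]. Bounding [1 / p] below by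
    [1 / 2 ^ (i + 1)] on each block [2 ^ i < p <= 2 ^ (i + 1)] and summing by
    parts ([dyadic_density_le_recip_sum]),

      S(m) >= (A (m + 1) + ... + A (2 m)) / 2 + (A (2 m) - A m) / 2.

    The first term is at least [d / 4], because the harmonic sum over [m, 2 m]
    is at least [1 / 2]. Once [S(m) <= d / 8] for all large [m], this says that
    [A (2 m) <= A m - d / 4]: each doubling of [m] costs a fixed amount, and
    [A], being nonnegative, cannot pay for it indefinitely. *)

(** * Counting functions *)

Lemma count_uptoS A N : count_upto A N.+1 = (count_upto A N + (N.+1 \in A))%N.
Proof. by rewrite /count_upto -(addn1 N) iotaD count_cat /= addn0 add1n addn1. Qed.

Lemma count_upto_sub A B N : A `<=` B -> (count_upto A N <= count_upto B N)%N.
Proof. by move=> AB; apply: sub_count => n /set_mem /AB /mem_set. Qed.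

(** * Chebyshev's lower bound for the number of primes *)

(** By Legendre's formula the exponent of [p] in ['C(m, n)] is a sum over [i] of
    [m %/ p ^ i - n %/ p ^ i - (m - n) %/ p ^ i]. Each term is at most [1], and
    the terms with [p ^ i > m] vanish, so that the exponent is at most the number
    of powers of [p] up to [m]. *)
Lemma expn_logn_bin_le p m n : prime p -> (n <= m)%N -> (0 < m)%N ->
  (p ^ logn p 'C(m, n) <= m)%N.
Proof.
move=> pr_p le_nm m_gt0.
have p_gt1 := prime_gt1 pr_p.
apply: leq_trans (trunc_logP p_gt1 m_gt0); rewrite leq_exp2l//.
suff : (logn p m`! <= trunc_log p m + (logn p n`! + logn p (m - n)`!))%N.
  rewrite -(bin_fact le_nm) !lognM ?muln_gt0 ?fact_gt0 ?bin_gt0//.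
  by rewrite leq_add2r.
(* Extending the range of Legendre's sum to a common bound lets the three
   factorials be compared termwise. *)
have logE k : (k <= m)%N -> logn p k`! = (\sum_(1 <= i < m.+1) k %/ p ^ i)%N.
  move=> le_km; rewrite logn_fact// [RHS](big_cat_nat _ (n := k.+1))//=.
  rewrite [X in (_ + X)%N]big_nat_cond [X in (_ + X)%N]big1 ?addn0//.
  move=> i /andP[/andP[lt_ki _] _].
  by rewrite divn_small// (leq_trans lt_ki)// ltnW// ltn_expl.
rewrite !logE ?leq_subr// -big_split/=.
have -> : (trunc_log p m = \sum_(1 <= i < m.+1) (i <= trunc_log p m))%N.
  rewrite (big_cat_nat _ (n := (trunc_log p m).+1))//=; last first.
    rewrite ltnS; apply: leq_trans (trunc_logP p_gt1 m_gt0).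
    by rewrite ltnW// ltn_expl.
  rewrite [X in (_ + X)%N]big_nat_cond [X in (_ + X)%N]big1 ?addn0; last first.
    by move=> i /andP[/andP[lt_i _] _]; rewrite leqNgt lt_i.
  rewrite big_nat_cond (eq_bigr (fun=> 1%N)); last first.
    by move=> i /andP[/andP[_ lt_i] _]; rewrite -[(i <= _)%N]ltnS lt_i.
  by rewrite -big_nat_cond sum_nat_const_nat subn1 muln1.
rewrite -big_split/=; apply: leq_sum => i _.
have [_|lt_i] := leqP i (trunc_log p m).
  rewrite -[in leqLHS](subnKC le_nm) addnC [leqRHS]addnC [(m - n + _)%N]addnC.
  exact: leq_divDl.
rewrite divn_small// (leq_trans (trunc_log_ltn m p_gt1))//.
by rewrite leq_exp2l.
Qed.

(** The binomial coefficient is the product of its prime powers; each is at most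
    [m], and they belong to distinct primes up to [m]. *)
Lemma bin_le_expn_prime_count m n : (n <= m)%N -> (0 < m)%N ->
  ('C(m, n) <= m ^ count_upto [set p | prime p] m)%N.
Proof.
move=> le_nm m_gt0; set C := 'C(m, n).
have C_gt0 : (0 < C)%N by rewrite bin_gt0.
have small p : p \in primes C -> (p <= m)%N.
  rewrite mem_primes => /and3P[pr_p _ dvd_pC].
  apply: leq_trans (expn_logn_bin_le pr_p le_nm m_gt0).
  by rewrite -[leqLHS]expn1 leq_exp2l ?prime_gt1// logn_gt0 mem_primes pr_p C_gt0.
have szC : (size (primes C) <= count_upto [set p | prime p] m)%N.
  rewrite /count_upto -size_filter uniq_leq_size ?primes_uniq// => p pC.
  have pr_p : prime p by move: pC; rewrite mem_primes => /andP[].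
  by rewrite mem_filter mem_iota add1n ltnS small// prime_gt0//= andbT mem_setE.
apply: leq_trans (_ : m ^ size (primes C) <= _)%N; last by rewrite leq_pexp2l.
rewrite [leqLHS]prod_prime_decomp// prime_decompE big_map/=.
have: {in primes C, forall p, p ^ logn p C <= m}%N.
  by move=> p; rewrite mem_primes => /and3P[pr_p _ _]; exact: expn_logn_bin_le.
elim: (primes C) => [|p s IHs] le_m; first by rewrite big_nil.
rewrite big_cons /= expnS leq_mul ?le_m ?mem_head// IHs// => q qs.
by rewrite le_m// in_cons qs orbT.
Qed.

Lemma expn2_le_bin n : (2 ^ n <= 'C(n.*2, n))%N.
Proof.
elim: n => [|n IHn]; first by rewrite bin0.
rewrite doubleS binS -[X in (_ + X)%N]bin_sub; last by rewrite -addnn; lia.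
rewrite (_ : n.*2.+1 - n = n.+1)%N; last by rewrite -addnn; lia.
by rewrite addnn -mul2n expnS leq_mul2l/= (leq_trans IHn)// binS leq_addl//.
Qed.

(** Up to [N = 2 ^ n.+1] there are at least [N / (2 log2 N)] primes: compare the
    bounds [2 ^ (N / 2)] and [N ^ pi(N)] for the central binomial coefficient
    ['C(N, N / 2)]. *)
Lemma prime_count_pow2 n :
  (2 ^ n <= n.+1 * count_upto [set p | prime p] (2 ^ n.+1))%N.
Proof.
rewrite -(leq_exp2l _ _ (ltnSn 1)) expnM.
apply: leq_trans (expn2_le_bin _) _.
by rewrite -mul2n -expnS bin_le_expn_prime_count ?expn_gt0// leq_exp2l.
Qed.

(** * Sums of reciprocals over dyadic ranges *)

Section Dyadic.
Context {R : realType}.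
Implicit Types (A : set nat).

Definition recip_sum A m n : R := \sum_(m.+1 <= p < n.+1 | p \in A) p%:R^-1.

Definition dyadic_density A i : R := (count_upto A (2 ^ i))%:R / 2 ^+ i.

Lemma dyadic_density_ge0 A i : 0 <= dyadic_density A i.
Proof. by rewrite divr_ge0// exprn_ge0. Qed.

Lemma recip_sum_cat A m n k : (m <= n <= k)%N ->
  recip_sum A m k = recip_sum A m n + recip_sum A n k.
Proof. by move=> /andP[mn nk]; rewrite /recip_sum (big_cat_nat _ (n := n.+1)). Qed.

Lemma count_le_recip_sum A m n : (m <= n)%N -> (0 < n)%N ->
  ((count_upto A n)%:R - (count_upto A m)%:R) / n%:R <= recip_sum A m n.
Proof.
move=> le_mn n_gt0.
suff : forall k, (k <= n - m)%N ->
    ((count_upto A (m + k))%:R - (count_upto A m)%:R) / n%:R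
      <= recip_sum A m (m + k).
  by move=> /(_ _ (leqnn _)); rewrite subnKC.
elim=> [|k IHk] le_k; first by rewrite addn0 subrr mul0r /recip_sum big_geq.
rewrite addnS (@recip_sum_cat _ _ (m + k)) ?leq_addr ?leqnSn//.
rewrite count_uptoS natrD addrAC mulrDl lerD ?IHk 1?ltnW//.
rewrite /recip_sum big_ltn_cond//= big_geq//.
case: (_ \in A); rewrite ?mul0r// mul1r addr0 lef_pV2 ?posrE ?ltr0n//.
by rewrite ler_nat; lia.
Qed.

(** Summation by parts on dyadic blocks: with [D] short for the dyadic density of
    [A], the block from [2 ^ i] to [2 ^ i.+1] contributes at least
    [D i.+1 - D i / 2 = D i.+1 / 2 + (D i.+1 - D i) / 2], and the second part
    telescopes. *)
Lemma dyadic_density_le_recip_sum A m n : (m <= n)%N ->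
  2^-1 * (\sum_(m <= i < n) dyadic_density A i.+1
    + (dyadic_density A n - dyadic_density A m))
  <= recip_sum A (2 ^ m) (2 ^ n).
Proof.
have base k : 2^-1 * (\sum_(k <= i < k) dyadic_density A i.+1
    + (dyadic_density A k - dyadic_density A k)) <= recip_sum A (2 ^ k) (2 ^ k).
  by rewrite /recip_sum !big_geq// subrr addr0 mulr0.
elim: n => [|n IHn]; first by rewrite leqn0 => /eqP->.
rewrite leq_eqVlt => /predU1P[->//|]; rewrite ltnS => le_mn.
rewrite (@recip_sum_cat _ _ (2 ^ n)); last by rewrite !leq_exp2l// le_mn leqnSn.
rewrite big_nat_recr//=.
have := @count_le_recip_sum A (2 ^ n) (2 ^ n.+1) _ _.
rewrite leq_exp2l// leqnSn expn_gt0 => /(_ isT isT).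
have := IHn le_mn.
have -> : ((count_upto A (2 ^ n.+1))%:R - (count_upto A (2 ^ n))%:R)
    / (2 ^ n.+1)%:R = dyadic_density A n.+1 - 2^-1 * dyadic_density A n.
  rewrite /dyadic_density natrX exprS; field.
  by rewrite expf_neq0.
by lra.
Qed.

Lemma harmonic_block_ge n : (0 < n)%N ->
  2^-1 <= \sum_(n <= i < n.*2) i.+1%:R^-1 :> R.
Proof.
move=> n_gt0.
apply: (@le_trans _ _ (\sum_(n <= i < n.*2) (n.*2)%:R^-1)).
  rewrite sumr_const_nat -addnn addnK -[_ *+ n]mulr_natr natrD.
  have : n%:R != 0 :> R by rewrite pnatr_eq0 -lt0n.
  move=> n0; rewrite -[n%:R + _]mulr2n -[n%:R *+ 2]mulr_natr invfM.
  by rewrite mulrAC mulVf// mul1r.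
apply: ler_sum_nat => i /andP[_ lt_i].
by rewrite lef_pV2 ?posrE ?ltr0n// ?double_gt0// ler_nat.
Qed.

(** A set whose dyadic densities are at least of the order [1 / i] have only
    small sums over the ranges from [N] to [N ^ 2] with [N] a large power of [2]:
    if those sums were at most [c / 8], every doubling of a large [i] would lower
    the density at [i] by [c / 4], and it would become negative. *)
Lemma recip_sum_large A (c : R) m0 : 0 < c ->
  (forall i, (m0 <= i)%N -> c <= i%:R * dyadic_density A i) ->
  exists2 m, (m0 <= m)%N & c / 8 < recip_sum A (2 ^ m) (2 ^ m.*2).
Proof.
move=> c_gt0 dens_ge; apply: contrapT => small.
have {}small m : (m0 <= m)%N -> recip_sum A (2 ^ m) (2 ^ m.*2) <= c / 8.
  by move=> le_m; rewrite leNgt; apply/negP => ?; apply: small; exists m.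
have drop m : (m0.+1 <= m)%N ->
    dyadic_density A m.*2 <= dyadic_density A m - c / 4.
  move=> lt_m; have le_m := ltnW lt_m.
  have m_gt0 : (0 < m)%N by rewrite (leq_ltn_trans _ lt_m).
  have le_m2 : (m <= m.*2)%N by rewrite -addnn leq_addr.
  have := dyadic_density_le_recip_sum A le_m2.
  have := small m le_m.
  suff : c * 2^-1 <= \sum_(m <= i < m.*2) dyadic_density A i.+1 by lra.
  apply: le_trans (_ : c * (\sum_(m <= i < m.*2) i.+1%:R^-1) <= _).
    by rewrite ler_pM2l// harmonic_block_ge.
  rewrite mulr_sumr; apply: ler_sum_nat => i /andP[le_mi _].
  by rewrite ler_pdivrMr ?ltr0n// mulrC dens_ge// (leq_trans le_m)// ltnW.
have iter_drop k :
    dyadic_density A (2 ^ k * m0.+1) <= dyadic_density A m0.+1 - k%:R * (c / 4).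
  elim: k => [|k IHk]; first by rewrite mul1n mul0r subr0.
  rewrite expnS -mulnA mul2n; apply: le_trans (drop _ _) _.
    by rewrite leq_pmull// expn_gt0.
  by rewrite -[k.+1%:R]natr1; lra.
have [k] : exists k : nat, dyadic_density A m0.+1 / (c / 4) < k%:R.
  by exists (Num.truncn (dyadic_density A m0.+1 / (c / 4))).+1; exact: truncnS_gt.
rewrite ltr_pdivrMr; last by rewrite divr_gt0.
have := iter_drop k; have := dyadic_density_ge0 A (2 ^ k * m0.+1); lra.
Qed.

End Dyadic.

(** * Lower limits of bounded sequences *)

(** The tail infima increase to the lower limit, so that they eventually exceed
    half of it. *)
Lemma limn_inf_neq0 (R : realType) (u : R^nat) :
  (forall n, 0 <= u n <= 1) -> limn_inf u <> 0 ->
  exists2 d : R, 0 < d & \forall n \near \oo, d <= u n.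
Proof.
move=> u01 nz.
have lbu : has_lbound (range u) by exists 0 => _ [n _ <-]; have /andP[] := u01 n.
have ubu : has_ubound (range u) by exists 1 => _ [n _ <-]; have /andP[] := u01 n.
have cu := cvg_infs_sup ubu lbu.
have lbn n : has_lbound (sdrop u n).
  by exists 0 => _ [k _ <-]; have /andP[] := u01 k.
have ge0 n : 0 <= infs u n.
  apply: lb_le_inf; first by exists (u n), n => /=.
  by move=> _ [k _ <-]; have /andP[] := u01 k.
have lim_ge0 : 0 <= limn_inf u.
  by apply: limr_ge; [apply/cvg_ex; eexists; exact: cu | exact: nearW].
have L_gt0 : 0 < limn_inf u by rewrite lt_neqAle lim_ge0 andbT eq_sym; apply/eqP.
exists (limn_inf u / 2); first by rewrite divr_gt0.
have lt2 : limn_inf u / 2 < limn (infs u) by rewrite -/(limn_inf u); lra.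
have cu' : cvgn (infs u) by apply/cvg_ex; eexists; exact: cu.
near=> n.
apply: le_trans (_ : infs u n <= _).
  by apply: ltW; near: n; apply: (cvgr_gt _ cu').
by apply: ge_inf => //; exists n => /=.
Unshelve. all: by end_near. Qed.

(** * The distance to the constant function 1 *)

Section Distance.
Context {R : realType}.
Implicit Types f : nat -> R[i].

Lemma Re_le1 (z : R[i]) : `|z| <= 1 -> complex.Re z <= 1.
Proof.
move=> z1; rewrite -lecR; apply: le_trans z1.
by apply: le_trans (normc_ge_Re z); rewrite lecR ler_norm.
Qed.

Lemma Re_lt1 (z : R[i]) : `|z| <= 1 -> z <> 1 -> complex.Re z < 1.
Proof.
move=> z1 zN1; rewrite lt_neqAle Re_le1// andbT; apply/eqP => Rez1; apply: zN1.
move: z z1 Rez1 => [a b] + /= a1; rewrite {a}a1 normc_def lecR /= => le1.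
suff -> : b = 0 by [].
apply/eqP; rewrite -sqrf_eq0 eq_le sqr_ge0 andbT.
have : Num.sqrt (1 ^+ 2 + b ^+ 2) ^+ 2 <= 1.
  by rewrite -[leRHS](expr1n _ 2) ler_sqr// ?nnegrE// sqrtr_ge0.
by rewrite sqr_sqrtr ?addr_ge0 ?sqr_ge0// expr1n; lra.
Qed.

(** Finitely many points of the closed unit disk other than [1] all lie to the
    left of a common vertical line [Re z = 1 - c]. *)
Lemma finitely_generated_gap f : unit_disk_valued f -> finitely_generated f ->
  exists2 c : R, 0 < c &
    forall p, prime p -> f p <> 1 -> c <= 1 - complex.Re (f p).
Proof.
move=> f_disk /finite_seqP[s fs].
have [c c_gt0 cP] : exists2 c : R, 0 < c &
    forall z, z \in s -> complex.Re z < 1 -> c <= 1 - complex.Re z.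
  elim: s {fs} => [|z s [c c_gt0 cP]]; first by exists 1.
  have [z_lt1|z_ge1] := ltP (complex.Re z) 1.
    exists (Num.min c (1 - complex.Re z)); first by rewrite lt_min c_gt0 subr_gt0.
    move=> w; rewrite in_cons => /predU1P[->|ws] w1.
      by rewrite ge_min lexx orbT.
    by rewrite ge_min cP.
  exists c => // w; rewrite in_cons => /predU1P[->|/cP//].
  by rewrite ltNge z_ge1.
exists c => // p pr_p fpN1; apply: cP.
  have : [set f p | p in [set p : nat | prime p]] (f p) by exists p.
  by rewrite fs.
by apply: Re_lt1 => //; apply: f_disk; exact: prime_gt0.
Qed.

(** With [x = 4 ^ n], the range of the distance contains the primes between
    [sqrt x = 2 ^ n] and [x], and each prime with [f p <> 1] contributes at least
    [c / p]. *)
Lemma pretentious_dist_ge f (c e : R) (n : nat) : unit_disk_valued f ->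
  (forall p, prime p -> f p <> 1 -> c <= 1 - complex.Re (f p)) ->
  e < 2^-1 ->
  c * recip_sum [set p | prime p /\ f p <> 1] (2 ^ n) (2 ^ n.*2)
    <= pretentious_dist f (fun=> 1) ((2 ^ n.*2)%:R `^ e) (2 ^ n.*2)%:R ^+ 2.
Proof.
move=> f_disk gap lt_e.
set x : R := (2 ^ n.*2)%:R.
have xe : x `^ e <= (2 ^ n)%:R.
  have -> : (2 ^ n)%:R = x `^ 2^-1 :> R.
    rewrite powR12_sqrt ?ler0n// /x -muln2 expnM [in RHS]natrX.
    by rewrite sqrtr_sqr ger0_norm ?ler0n.
  by apply: ler_powR; rewrite ?ler1n ?expn_gt0// ltW.
have termE p : pretentious_term f (fun=> 1) p = (1 - complex.Re (f p)) / p%:R.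
  by rewrite /pretentious_term conjc1 mulr1.
have term_ge0 p : prime p -> 0 <= pretentious_term f (fun=> 1) p.
  move=> pr_p; rewrite termE divr_ge0// subr_ge0 Re_le1// f_disk//.
  exact: prime_gt0.
rewrite /pretentious_dist sqr_sqrtr; last first.
  by apply: sumr_ge0 => p /andP[pr_p _]; exact: term_ge0.
rewrite /recip_sum natrK mulr_sumr.
rewrite big_mkcond (big_nat_widenl _ 0)//= -big_mkcondl /=.
rewrite big_mkcond [leRHS]big_mkcond/=.
apply: ler_sum_nat => p /andP[_ le_p].
case: ifP => [/andP[pA lt_p]|_]; last by case: ifP => // /andP[/term_ge0].
move: pA; rewrite inE => -[pr_p fp].
rewrite pr_p ler_nat -ltnS le_p andbT (le_lt_trans xe) ?ltr_nat//=.
by rewrite termE ler_wpM2r ?invr_ge0// gap.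
Qed.
End Distance.

Theorem theorem1p3 (R : realType) (f : nat -> R[i])
  (f_disk : unit_disk_valued f)
  (f_mult : multiplicative_fun f)
  (f_fg : finitely_generated f)
  (f_nonpret : ~ pretentious f)
  (f_dist : exists eps : R -> R,
     (\forall x \near +oo, (ln (ln x))^-1 < eps x < 2^-1) /\
     pretentious_dist f (fun=> 1) (x `^ eps x) x @[x --> +oo] --> (0 : R)) :
  lower_prime_density R [set p : nat | prime p /\ f p <> 1] = 0.
Proof.
set P := [set p | _].
apply: contrapT => dens_neq0.
have subP N : (count_upto P N <= count_upto [set p | prime p] N)%N.
  by apply: count_upto_sub => p [].
have [n|d d_gt0] := limn_inf_neq0 _ dens_neq0.
  rewrite divr_ge0//=; have [->|pi_gt0] := posnP (count_upto [set p | prime p] n).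
    by rewrite invr0 mulr0.
  by rewrite ler_pdivrMr ?ltr0n// mul1r ler_nat.
move=> [N0 _ N0P].
have [c c_gt0 gap] := finitely_generated_gap f_disk f_fg.
have [eps [eps_bd dist0]] := f_dist.
(* [d] bounds the relative density from below, and [1 / 2] is the constant in
   [prime_count_pow2]. *)
have dens_ge i : (N0.+1 <= i)%N -> d / 2 <= i%:R * dyadic_density P i :> R.
  case: i => // i; rewrite ltnS => le_i.
  have le_N0 : (N0 <= 2 ^ i.+1)%N.
    by rewrite (leq_trans le_i)// ltnW// (leq_trans (ltnSn _))// ltnW// ltn_expl.
  have pi_ge := prime_count_pow2 i.
  have pi_gt0 : (0 < count_upto [set p | prime p] (2 ^ i.+1))%N.
    rewrite lt0n; apply/eqP => pi0; move: pi_ge.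
    by rewrite pi0 muln0 leqn0 expn_eq0.
  have := N0P _ le_N0; rewrite /= ler_pdivlMr ?ltr0n// => count_ge.
  rewrite /dyadic_density mulrA ler_pdivlMr ?exprn_gt0//.
  set pi := count_upto _ _ in pi_ge pi_gt0 count_ge.
  apply: le_trans (_ : i.+1%:R * (d * pi%:R) <= _); last first.
    by rewrite ler_pM2l ?ltr0n.
  rewrite exprS [leLHS]mulrA divfK// mulrCA ler_pM2l//.
  by rewrite -natrM -natrX ler_nat.
(* [d / 16] is an eighth of the constant [d / 2] just obtained, which is the
   threshold that [recip_sum_large] exceeds. *)
have small : \forall x \near +oo,
    pretentious_dist f (fun=> 1) (x `^ eps x) x ^+ 2 < c * (d / 16).
  have dist0' : pretentious_dist f (fun=> 1) (x `^ eps x) x ^+ 2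
      @[x --> +oo] --> (0 : R).
    by rewrite -[X in _ --> X](mulr0 0); exact: cvgM.
  by apply: (cvgr_lt _ dist0'); rewrite mulr_gt0// divr_gt0.
have [M [_ MP]] : \forall x \near +oo,
    eps x < 2^-1 /\
    pretentious_dist f (fun=> 1) (x `^ eps x) x ^+ 2 < c * (d / 16).
  by near=> x; split; [near: x; apply: filterS eps_bd => x /andP[] | near: x].
have d2 : 0 < d / 2 by rewrite divr_gt0.
pose m0 := maxn N0.+1 (Num.truncn M).+1.
have [m|m le_m] := @recip_sum_large R P _ m0 d2.
  by rewrite geq_max => /andP[/dens_ge].
apply/negP; rewrite -leNgt -(ler_pM2l c_gt0).
have [] := MP (2 ^ m.*2)%:R.
  apply: lt_le_trans (truncnS_gt M) _; rewrite ler_nat.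
  apply: leq_trans (_ : m <= _)%N; first by rewrite (leq_trans _ le_m)// leq_maxr.
  by rewrite (leq_trans _ (ltnW (ltn_expl _ (ltnSn 1))))// -addnn leq_addr.
move=> /(pretentious_dist_ge m f_disk gap) => le1 lt2.
apply: le_trans le1 _; lra.
Unshelve. all: by end_near. Qed.
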